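(* Let $p$ be a prime and let $\langle X|R\rangle$ be a group presentation, where $X$ is finite, $|R|>0$, and $\mathrm{def}_p\langle X|R\rangle=0$. Suppose that, for some prime $q\neq p$, each element of $R$ is a $q$-th power in the free group on $X$. Then the group $\Gamma\cong\langle X|R\rangle$ contains a finite index subgroup of positive $p$-deficiency.
   Context: Let $F$ be the free group on a finite set $X$. For a non-trivial $w\in F$, the $p$-valuation $\nu_p(w)$ is the largest integer $k$ such that $w=v^{p^k}$ for some $v\in F$. For a presentation $\langle X|R\rangle$ with $X$ finite ($R\subseteq F$ a possibly infinite set of non-trivial elements) its $p$-deficiency is $\mathrm{def}_p\langle X|R\rangle=|X|-1-\sum_{r\in R}p^{-\nu_p(r)}$ (equal to $-\infty$ if the sum diverges). The $p$-deficiency $\mathrm{def}_p\,\Gamma$ of a finitely generated group $\Gamma$ is the supremum of $\mathrm{def}_p\langle X|R\rangle$ over all presentations $\langle X|R\rangle$ of $\Gamma$ with a finite generating set $X$. *)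

(* Defs.v *)
From HB Require Import structures.
From mathcomp Require Import all_boot all_order all_algebra.
From mathcomp Require Import boolp classical_sets functions cardinality.
From mathcomp Require Import reals constructive_ereal ereal esum.

Set Implicit Arguments.
Unset Strict Implicit.
Unset Printing Implicit Defensive.

Local Open Scope classical_set_scope.
Local Open Scope group_scope.

Section FreeGroup.
Variable X : eqType.

(* (x, false) stands for the generator x and (x, true) for its inverse. *)
Definition letter := (X * bool)%type.

Definition letter_inv (a : letter) : letter := (a.1, ~~ a.2).

Definition reduced (w : seq letter) : bool :=
  sorted (fun a b => b != letter_inv a) w.

(* The reduced form of a :: w, for w reduced. *)
Definition push (a : letter) (w : seq letter) : seq letter :=
  if w is b :: w' then if b == letter_inv a then w' else a :: w else [:: a].

(* The reduced form of u ++ v, for v reduced. *)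
Definition word_mul (u v : seq letter) : seq letter := foldr push v u.

Definition word_inv (u : seq letter) : seq letter := rev (map letter_inv u).

Lemma letter_invK : involutive letter_inv.
Proof. by case=> x b; rewrite /letter_inv /= negbK. Qed.

Lemma reduced_push a w : reduced w -> reduced (push a w).
Proof.
case: w => [|b w] //= rw; case: eqP => [_|/eqP ne] /=; last by rewrite ne.
exact: path_sorted rw.
Qed.

Lemma pushK a w : reduced w -> push (letter_inv a) (push a w) = w.
Proof.
case: w => [|b w] /=; first by rewrite letter_invK eqxx.
case: eqP => [->|_] /=; last by rewrite letter_invK eqxx.
by case: w => [|c w] //= /andP[/negPf ->].
Qed.

Lemma reduced_word_mul u v : reduced v -> reduced (word_mul u v).
Proof. by move=> rv; elim: u => //= a u; apply: reduced_push. Qed.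

Lemma word_mul_push a u v :
  reduced v -> word_mul (push a u) v = push a (word_mul u v).
Proof.
move=> rv; case: u => [|b u] //=; case: eqP => [->|_] //=.
by have := pushK (letter_inv a) (reduced_word_mul u rv); rewrite letter_invK.
Qed.

Lemma word_mulA u v w :
  reduced w -> word_mul u (word_mul v w) = word_mul (word_mul u v) w.
Proof. by move=> rw; elim: u => //= a u ->; rewrite word_mul_push. Qed.

Lemma word_mulw0 u : reduced u -> word_mul u [::] = u.
Proof.
elim: u => //= a u IHu rau; rewrite (IHu (path_sorted rau)).
by case: u rau {IHu} => //= b u /andP[/negPf ->].
Qed.

Lemma reduced_word_inv u : reduced u -> reduced (word_inv u).
Proof.
rewrite /reduced /word_inv rev_sorted sorted_map; apply: sub_sorted.
by move=> a b /=; rewrite letter_invK eq_sym.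
Qed.

Lemma word_mulVw u : reduced u -> word_mul (word_inv u) u = [::].
Proof.
elim: u => //= a u IHu rau.
rewrite /word_inv /= rev_cons /word_mul foldr_rcons /= letter_invK eqxx.
exact: IHu (path_sorted rau).
Qed.

Lemma word_invK : involutive word_inv.
Proof.
by move=> u; rewrite /word_inv map_rev revK -map_comp map_id_in // => a _;
  apply: letter_invK.
Qed.

End FreeGroup.

Record free_group (X : eqType) := FreeGroup {
  word :> seq (letter X);
  word_reduced : reduced word
}.

HB.instance Definition _ (X : eqType) := [isSub for @word X].
HB.instance Definition _ (X : eqType) := [Equality of free_group X by <:].
HB.instance Definition _ (X : choiceType) := [Choice of free_group X by <:].

Section FreeGroupLaw.
Variable X : choiceType.
Implicit Types u v w : free_group X.

Definition free_one : free_group X := @FreeGroup X [::] isT.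

Definition free_mul u v : free_group X :=
  FreeGroup (reduced_word_mul u (word_reduced v)).

Definition free_inv u : free_group X :=
  FreeGroup (reduced_word_inv (word_reduced u)).

Lemma free_mulA : associative free_mul.
Proof. by move=> u v w; apply/val_inj/word_mulA/word_reduced. Qed.

Lemma free_mul1g : left_id free_one free_mul.
Proof. by move=> u; apply/val_inj. Qed.

Lemma free_mulg1 : right_id free_one free_mul.
Proof. by move=> u; apply/val_inj/word_mulw0/word_reduced. Qed.

Lemma free_mulVg : left_inverse free_one free_inv free_mul.
Proof. by move=> u; apply/val_inj/word_mulVw/word_reduced. Qed.

Lemma free_mulgV : right_inverse free_one free_inv free_mul.
Proof.
move=> u; apply/val_inj; rewrite /= -{1}[word u]word_invK.
exact/word_mulVw/reduced_word_inv/word_reduced.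
Qed.

HB.instance Definition _ := isGroup.Build (free_group X)
  free_mulA free_mul1g free_mulg1 free_mulVg free_mulgV.

End FreeGroupLaw.

Definition normal_subgroup (G : groupType) (N : set G) : Prop :=
  [/\ N 1,
      (forall x y, N x -> N y -> N (x * y)),
      (forall x, N x -> N x^-1)
    & (forall x y, N x -> N (x ^ y))].

Definition normal_closure (G : groupType) (A : set G) : set G :=
  smallest (@normal_subgroup G) A.

(* <X | R> is a presentation of G: some epimorphism from the free group on X
   onto G has the normal closure of R as its kernel. *)
Definition presents (X : finType) (R : set (free_group X)) (G : groupType) :
    Prop :=
  exists phi : {multiplicative free_group X -> G},
    range phi = setT /\ phi @^-1` [set 1] = normal_closure R.

Definition is_power (G : groupType) (n : nat) (x : G) : Prop :=
  exists y : G, x = y ^+ n.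

(* The largest k such that w is a (p ^ k)-th power.  It exists for p prime and
   w != 1, since a non-trivial element of a free group is an n-th power for
   only finitely many n; the default value 0 is used only otherwise. *)
Definition pvaluation (p : nat) (X : finType) (w : free_group X) : nat :=
  xget 0%N [set k | is_power (p ^ k)%N w /\
                    forall j, is_power (p ^ j)%N w -> (j <= k)%N].

(* A divergent sum is +oo, which makes the deficiency -oo. *)
Definition pres_pdeficiency (K : realType) (p : nat) (X : finType)
    (R : set (free_group X)) : \bar K :=
  ((#|X|%:R - 1)%R%:E - (\esum_(r in R) (p%:R ^- pvaluation p r)%:E)%R)%E.

Definition pdeficiency (K : realType) (p : nat) (G : groupType) : \bar K :=
  ereal_sup [set d | exists (X : finType) (R : set (free_group X)),
    [/\ ~ R 1, presents R G & d = pres_pdeficiency K p R]].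

Definition subgroup (G : groupType) (S : groupClosed G) : Type :=
  {x : G | x \in S}.

Lemma groupClosed_group_closed (G : groupType) (S : groupClosed G) :
  group_closed (fun x : G => x \in S).
Proof. by split; [apply: gpred1 | apply: gpredF]. Qed.

HB.instance Definition _ (G : groupType) (S : groupClosed G) :=
  SubChoice.on (subgroup S).
HB.instance Definition _ (G : groupType) (S : groupClosed G) :=
  SubChoice_isSubGroup.Build G (fun x : G => x \in S) (subgroup S)
    (groupClosed_group_closed S).

Definition left_coset (G : groupType) (S : {pred G}) (x : G) : set G :=
  [set x * y | y in [set` S]].

Definition finite_index (G : groupType) (S : {pred G}) : Prop :=
  finite_set (range (left_coset S)).

(* Main.v *)
Require Import Defs.
From HB Require Import structures.
From mathcomp Require Import all_boot all_order all_algebra.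
From mathcomp Require Import all_fingroup all_solvable ring.
From mathcomp Require Import boolp classical_sets functions cardinality.
From mathcomp Require Import reals constructive_ereal ereal esum.

(* Write each relator as r = u ^ q. As free groups are residually finite
   q-groups, some finite q-group Q of least order is a quotient f : F -> Q not
   killing every u. By minimality each f u lies in a central subgroup of order
   q, so f kills every r and Q is a quotient of the presented group. Let S be
   the image of ker f, of index n = #|Q|. It is generated by the n |X| edges of
   the Cayley graph of Q, subject to n - 1 relators contracting transversal
   paths and to the relators r read from each vertex t. Since r = v ^ (p ^ k)
   forces v into ker f (p is prime to n), p-valuations do not drop, so this
   presentation would have p-deficiency at least n * 0 = 0. But for r0 = u0 ^ q
   with f u0 != 1, r0 read from f u0 is conjugate by u0 to r0 read from 1, so
   one of the two is redundant and the deficiency is positive. *)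

Set Implicit Arguments.
Unset Strict Implicit.
Unset Printing Implicit Defensive.

Import Order.TTheory GRing.Theory Num.Theory.
Local Open Scope classical_set_scope.
Local Open Scope group_scope.

(** * Words read along paths, and homomorphisms out of free groups *)

Section Walk.
Variables (X : choiceType) (G : groupType) (T : Type).
Variables (move : letter X -> T -> T) (c : T -> letter X -> G).
Hypothesis moveK : forall a, cancel (move a) (move (letter_inv a)).
Hypothesis cV : forall a t, c (move a t) (letter_inv a) = (c t a)^-1.

(** With a one-point [T] this evaluates words in [G]; with [T] a group acted on by translations it
    is Reidemeister rewriting. By [moveK] and [cV], a cancelling pair of letters contributes
    nothing. *)
Fixpoint walk (t : T) (w : seq (letter X)) : G :=
  if w is a :: w' then c t a * walk (move a t) w' else 1.

Definition walk_end (t : T) (w : seq (letter X)) : T :=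
  foldl (fun t a => move a t) t w.

Lemma walk_push t a w : walk t (push a w) = c t a * walk (move a t) w.
Proof.
case: w => [|b w] //=; case: eqP => [->|_] //=.
by rewrite cV moveK mulVKg.
Qed.

Lemma walk_word_mul t u v :
  walk t (word_mul u v) = walk t u * walk (walk_end t u) v.
Proof.
elim: u t => [|a u IHu] t /=; first by rewrite mul1g.
by rewrite walk_push IHu mulgA.
Qed.

End Walk.

Section Generators.
Variable X : choiceType.

Definition free_letter (a : letter X) : free_group X :=
  @FreeGroup X [:: a] isT.

Lemma free_letterV a : free_letter (letter_inv a) = (free_letter a)^-1.
Proof. exact/val_inj. Qed.

Lemma free_group_cons a w (raw : reduced (a :: w)) (rw : reduced w) :
  FreeGroup raw = free_letter a * FreeGroup rw.
Proof.
apply/val_inj => /=; case: w raw {rw} => //= b w /andP[nba _].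
by rewrite (negPf nba).
Qed.

Lemma free_group_ind (P : free_group X -> Prop) :
  P 1 -> (forall a w, P w -> P (free_letter a * w)) -> forall w, P w.
Proof.
move=> P1 PM [w rw]; elim: w rw => [|a w IHw] rw.
  by rewrite (_ : FreeGroup rw = 1) //; apply/val_inj.
by rewrite (free_group_cons rw (path_sorted rw)); apply/PM/IHw.
Qed.

End Generators.

Section Lift.
Variables (X : choiceType) (G : groupType) (g : X -> G).

Definition lift_letter (_ : unit) (a : letter X) : G :=
  if a.2 then (g a.1)^-1 else g a.1.

Lemma lift_letterV a t : lift_letter t (letter_inv a) = (lift_letter t a)^-1.
Proof. by case: a => x [] //=; rewrite /lift_letter /= invgK. Qed.

Definition free_lift (w : free_group X) : G :=
  walk (fun _ t => t) lift_letter tt w.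

Fact free_liftM : {morph free_lift : u v / u * v}.
Proof.
move=> u v; rewrite /free_lift walk_word_mul //; last exact: lift_letterV.
by case: (walk_end _ tt u).
Qed.

Fact free_lift1 : free_lift 1 = 1. Proof. by []. Qed.

HB.instance Definition _ := isUMagmaMorphism.Build _ _ free_lift
  (conj free_lift1 free_liftM).

Lemma free_lift_letter x b :
  free_lift (free_letter (x, b)) = if b then (g x)^-1 else g x.
Proof. by rewrite /free_lift /= mulg1. Qed.

End Lift.

(** [presents] only provides a map respecting products; cancellation in [H] shows that it preserves
    1. *)
Lemma multiplicative_group_morphism (G H : groupType)
    (f : {multiplicative G -> H}) :
  exists g : UMagmaMorphism.type G H, g = f :> (G -> H).
Proof.
have f1 : f 1 = 1 by apply: (@mulgI _ (f 1)); rewrite -gmulfM !mulg1.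
pose g := isUMagmaMorphism.Build G H f (f1, @gmulfM _ _ f).
by exists (HB.pack_for (UMagmaMorphism.type G H) (f : G -> H) g).
Qed.

Section NormalClosure.
Variable G : groupType.
Implicit Types (A N : set G).

Lemma normal_closure_normal A : normal_subgroup (normal_closure A).
Proof.
split.
- by move=> N [[]].
- by move=> x y Nx Ny N [nN AN]; case: (nN) => _ + _ _; apply;
    [apply: Nx | apply: Ny].
- by move=> x Nx N [nN AN]; case: (nN) => _ _ + _; apply; apply: Nx.
- by move=> x y Nx N [nN AN]; case: (nN) => _ _ _; apply; apply: Nx.
Qed.

Lemma sub_normal_closure A : A `<=` normal_closure A.
Proof. by move=> x Ax N [_]; apply. Qed.

Lemma normal_closure_min A N :
  normal_subgroup N -> A `<=` N -> normal_closure A `<=` N.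
Proof. by move=> nN AN x; apply. Qed.

End NormalClosure.

(** * Reidemeister rewriting *)

(* The Reidemeister rewriting process for the kernel of [f]: its generators are
   the edges of the Cayley graph of [Q], the edge [(t, x)] going from [t] to
   [t * f x], and [rewriting t w] reads the path labelled [w] from [t]. *)
Section Rewriting.
Variables (X : finType) (Q : finGroupType).
Variable f : UMagmaMorphism.type (free_group X) Q.

(** An inverse letter read from [t] runs backwards along the edge that ends at [t], whose source is
    [t * f (free_letter a)]. *)
Definition rewrite_letter (t : Q) (a : letter X) : free_group (Q * X)%type :=
  if a.2 then (free_letter ((t * f (free_letter a), a.1), false))^-1
  else free_letter ((t, a.1), false).

Definition rewriting (t : Q) (w : free_group X) : free_group (Q * X)%type :=
  walk (fun a t => t * f (free_letter a)) rewrite_letter t w.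

Let moveK a :
  cancel (fun t => t * f (free_letter a))
         (fun t => t * f (free_letter (letter_inv a))).
Proof. by move=> t; rewrite free_letterV gmulfV mulgK. Qed.

Let rewrite_letterV a t :
  rewrite_letter (t * f (free_letter a)) (letter_inv a) =
  (rewrite_letter t a)^-1.
Proof.
by rewrite /rewrite_letter moveK; case: a => x [] //=; rewrite invgK.
Qed.

Lemma walk_end_free t (w : free_group X) :
  walk_end (fun a t => t * f (free_letter a)) t w = t * f w.
Proof.
case: w => w rw /=; elim: w rw t => [|a w IHw] rw t /=.
  by rewrite (_ : FreeGroup rw = 1) ?gmulf1 ?mulg1 //; apply/val_inj.
by rewrite (IHw (path_sorted rw)) -mulgA -gmulfM -free_group_cons.
Qed.

Lemma rewritingM t u v :
  rewriting t (u * v) = rewriting t u * rewriting (t * f u) v.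
Proof.
by rewrite /rewriting walk_word_mul ?walk_end_free.
Qed.

Lemma rewriting1 t : rewriting t 1 = 1. Proof. by []. Qed.

Lemma rewriting_letter t a : rewriting t (free_letter a) = rewrite_letter t a.
Proof. by rewrite /rewriting /= mulg1. Qed.

Lemma rewritingV t u : rewriting t u^-1 = (rewriting (t * f u^-1) u)^-1.
Proof.
by apply/eqP; rewrite -mulg_eq1 -rewritingM mulVg.
Qed.

Lemma rewritingX t v n :
  f v = 1 -> rewriting t (v ^+ n) = rewriting t v ^+ n.
Proof.
move=> fv; elim: n => [|n IHn]; first by rewrite !expg0 rewriting1.
by rewrite !expgS rewritingM fv mulg1 IHn.
Qed.

(** Forgetting the source vertex of every edge recovers the word. *)
Lemma rewriting_inj t : injective (rewriting t).
Proof.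
pose forget (y : Q * X) := free_letter (y.2, false).
apply: (can_inj (g := free_lift forget)) => w.
elim/free_group_ind: w t => [|a w IHw] t; first exact: gmulf1.
rewrite rewritingM gmulfM /= IHw; congr (_ * w).
rewrite rewriting_letter /rewrite_letter; case: a => x [] /=.
  by rewrite gmulfV /= free_lift_letter -free_letterV.
by rewrite free_lift_letter.
Qed.

Variable s : Q -> free_group X.
Hypothesis fs : cancel s f.

(** Each edge goes to its Schreier generator for the transversal [s]. *)
Definition unrewriting : free_group (Q * X)%type -> free_group X :=
  free_lift (fun y : Q * X =>
    s y.1 * free_letter (y.2, false) *
    (s (y.1 * f (free_letter (y.2, false))))^-1).

HB.instance Definition _ := UMagmaMorphism.on unrewriting.

(** The transversal factors of consecutive edges cancel, leaving those at the two ends of the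
    path. *)
Lemma unrewritingK t w :
  unrewriting (rewriting t w) = s t * w * (s (t * f w))^-1.
Proof.
elim/free_group_ind: w t => [|a w IHw] t.
  by rewrite rewriting1 !gmulf1 !mulg1 mulgV.
rewrite rewritingM gmulfM /= IHw rewriting_letter gmulfM mulgA.
rewrite mulgA (mulgA (s t)); congr (_ * w * (s _)^-1); last by rewrite mulgA.
suff -> : unrewriting (rewrite_letter t a) =
   s t * free_letter a * (s (t * f (free_letter a)))^-1 by rewrite mulgVK.
rewrite /rewrite_letter; case: a => x [] /=; rewrite /unrewriting; last first.
  by rewrite free_lift_letter.
rewrite gmulfV /= free_lift_letter /= !invgM invgK -free_letterV /letter_inv /=.
by rewrite (_ : t * _ * _ = t) ?mulgA //; apply: (moveK (x, true)).
Qed.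

Lemma unrewriting_kernel y : f (unrewriting y) = 1.
Proof.
elim/free_group_ind: y => [|[[t x] b] y IHy]; first by rewrite !gmulf1.
rewrite gmulfM gmulfM IHy mulg1 /= /unrewriting free_lift_letter /=.
by case: b; rewrite ?gmulfV !gmulfM gmulfV !fs /= mulgV ?invg1.
Qed.

Variable N : set (free_group (Q * X)%type).
Hypotheses (nN : normal_subgroup N) (sN : forall t, N (rewriting 1 (s t))).

(** The reading of a Schreier generator differs from its edge only by conjugates of readings of
    transversal elements and their inverses, which lie in [N]. By multiplicativity, single edges
    suffice. *)
Lemma rewritingK_mod y : N ((rewriting 1 (unrewriting y))^-1 * y).
Proof.
have [N1 NM NV NJ] := nN.
have step u v : N ((rewriting 1 (unrewriting u))^-1 * u) ->
   N ((rewriting 1 (unrewriting v))^-1 * v) ->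
   N ((rewriting 1 (unrewriting (u * v)))^-1 * (u * v)).
  move=> Nu Nv; rewrite gmulfM /= rewritingM unrewriting_kernel mul1g invgM.
  set a := rewriting _ _ in Nu *; set b := rewriting _ _ in Nv *.
  have -> : b^-1 * a^-1 * (u * v) = (a^-1 * u) ^ b * (b^-1 * v).
    by rewrite /conjg !mulgA mulgK.
  exact/NM/Nv/NJ.
elim/free_group_ind: y => [|a y Ny]; first by rewrite gmulf1 rewriting1 mulVg.
apply: step => // {y Ny}.
suff pos t x : N ((rewriting 1 (unrewriting (free_letter ((t, x), false))))^-1 *
                  free_letter ((t, x), false)).
  case: a => [[t x] []] //; rewrite (free_letterV (_, false)).
  have := pos t x; set g := free_letter _ => Ng.
  rewrite gmulfV rewritingV mul1g invgK gmulfV unrewriting_kernel invg1.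
  have -> : rewriting 1 (unrewriting g) * g^-1 =
     ((rewriting 1 (unrewriting g))^-1 * g)^-1 ^ g^-1.
    by rewrite /conjg invgK invgM invgK !mulgA mulgV mul1g.
  exact/NJ/NV.
rewrite /unrewriting free_lift_letter /= -/unrewriting.
rewrite !rewritingM fs !mul1g !gmulfM fs.
rewrite rewriting_letter /rewrite_letter /=; set g := free_letter _.
rewrite rewritingV gmulfV fs mulgV.
set u := rewriting _ (s t); set v := rewriting _ (s _).
have -> : (u * g * v^-1)^-1 * g = v * u^-1 ^ g.
  by rewrite !invgM invgK /conjg !mulgA.
by apply: NM; [apply: sN | apply/NJ/NV/sN].
Qed.

End Rewriting.

(** * Finite index subgroups and their presentations *)

Section KernelImage.
Variables (F G H : groupType) (phi : UMagmaMorphism.type F G).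
Variable f : UMagmaMorphism.type F H.

Definition kernel_image : {pred G} :=
  fun g => `[< exists2 w, f w = 1 & phi w = g >].

Let kernel_imageP g :
  reflect (exists2 w, f w = 1 & phi w = g) (g \in kernel_image).
Proof. exact: asboolP. Qed.

Fact kernel_imageM : mulg_closed kernel_image.
Proof.
move=> _ _ /kernel_imageP[u fu <-] /kernel_imageP[v fv <-].
by apply/kernel_imageP; exists (u * v); rewrite gmulfM // fu fv mulg1.
Qed.

Fact kernel_image1 : 1 \in kernel_image.
Proof. by apply/kernel_imageP; exists 1; rewrite gmulf1. Qed.

Fact kernel_imageV : invg_closed kernel_image.
Proof.
move=> _ /kernel_imageP[u fu <-].
by apply/kernel_imageP; exists u^-1; rewrite gmulfV // fu invg1.
Qed.

HB.instance Definition _ := isMulClosed.Build G kernel_image kernel_imageM.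
HB.instance Definition _ := isMul1Closed.Build G kernel_image kernel_image1.
HB.instance Definition _ := isInvClosed.Build G kernel_image kernel_imageV.

End KernelImage.

(** [w] and [s (f w)] differ by an element of the kernel of [f], so every coset is that of some
    [phi (s t)]. *)
Lemma kernel_image_finite_index (F G : groupType) (H : finGroupType)
    (phi : UMagmaMorphism.type F G) (f : UMagmaMorphism.type F H)
    (s : H -> F) :
  cancel s f -> range phi = setT -> finite_index (kernel_image phi f).
Proof.
move=> fs phi_surj; rewrite /finite_index.
apply: (@sub_finite_set _ _ [set left_coset (kernel_image phi f) (phi (s t)) |
                               t in [set: H]]); last first.
  exact/finite_image/finite_finset.
move=> _ [g _ <-]; have [w _ <-] : range phi g by rewrite phi_surj.
exists (f w) => //; apply/seteqP; split=> _ [y /= Sy <-].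
  exists (phi (w^-1 * s (f w)) * y).
    rewrite /= gpredM //; apply/asboolP; exists (w^-1 * s (f w)) => //.
    by rewrite gmulfM gmulfV fs mulVg.
  by rewrite mulgA -gmulfM mulVKg.
exists (phi ((s (f w))^-1 * w) * y).
  rewrite /= gpredM //; apply/asboolP; exists ((s (f w))^-1 * w) => //.
  by rewrite gmulfM gmulfV fs mulVg.
by rewrite mulgA -gmulfM mulVKg.
Qed.

(** The epimorphism is [unrewriting] followed by [phi]. It kills [P] by [unrewritingK]. Conversely,
    an element [y] of its kernel agrees modulo [P] with the reading of [unr y], which follows from
    the readings of [R] from all vertices. *)
Lemma presents_finite_index_subgroup (X : finType) (Q : finGroupType)
    (f : UMagmaMorphism.type (free_group X) Q) (s : Q -> free_group X)
    (R : set (free_group X)) (P : set (free_group (Q * X)%type))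
    (G : groupType) :
  cancel s f -> s 1 = 1 -> presents R G -> (forall r, R r -> f r = 1) ->
  (forall t, normal_closure P (rewriting f 1 (s t))) ->
  (forall t r, R r -> normal_closure P (rewriting f t r)) ->
  (forall y, P y -> (exists t, y = rewriting f 1 (s t)) \/
     exists t r, R r /\ y = rewriting f t r) ->
  exists S : groupClosed G, finite_index S /\ presents P (subgroup S).
Proof.
move=> fs s1 [phi' [phi_surj phi_ker]] fR NE NR sPER.
have [phi phiE] := multiplicative_group_morphism phi'.
rewrite -{}phiE {phi'} in phi_surj phi_ker.
pose S := GroupClosed.clone G (kernel_image phi f) _; exists S.
split; first exact: kernel_image_finite_index fs phi_surj.
pose unr := unrewriting f s.
have nNP := normal_closure_normal P.
have psi_in y : phi (unr y) \in S.
  by apply/asboolP; exists (unr y) => //; apply: unrewriting_kernel.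
pose psi y : subgroup S := exist (fun g => g \in S) _ (psi_in y).
have psiM : {morph psi : x y / x * y}.
  by move=> x y; apply/val_inj; rewrite /= /unr !gmulfM.
pose psiI := isMultiplicative.Build _ _ psi psiM.
exists (HB.pack_for {multiplicative _ -> _} psi psiI); split=> /=.
  apply/seteqP; split=> // -[g Sg] _; have /asboolP[w fw phiw] := Sg.
  exists (rewriting f 1 w) => //; apply/val_inj => /=.
  by rewrite /unr unrewritingK // fw mulg1 !s1 mul1g invg1 mulg1.
have kerE y : psi y = 1 <-> normal_closure R (unr y).
  rewrite -phi_ker /=; split=> [/(congr1 val)//|e]; exact/val_inj.
have [_ NRM NRV NRJ] := normal_closure_normal R.
apply/seteqP; split=> y /=; rewrite kerE; last first.
  move: y; apply: (@normal_closure_min _ _ (unr @^-1` normal_closure R)).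
    split=> [|x y /= Nx Ny|x /= Nx|x y /= Nx] /=; rewrite /unr.
    + by rewrite gmulf1; case: (normal_closure_normal R).
    + by rewrite gmulfM; apply: NRM.
    + by rewrite gmulfV; apply: NRV.
    + by rewrite gmulfJ; apply: NRJ.
  move=> y /sPER[[t ->]|[t [r [Rr ->]]]]; rewrite /= /unr unrewritingK //.
    by rewrite s1 fs !mul1g mulgV; case: (normal_closure_normal R).
  rewrite (fR _ Rr) mulg1; have := NRJ r (s t)^-1; rewrite /conjg invgK mulgA.
  by apply; apply: sub_normal_closure.
have [N1 NM NV NJ] := nNP.
(* The quantifier over [t] makes [M] stable under conjugation, which moves the vertex where the
   reading starts. *)
pose M := [set w | f w = 1 /\ forall t, normal_closure P (rewriting f t w)].
move=> Ry; have [_ /(_ 1) Ny] : M (unr y).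
  move: (unr y) Ry; apply: normal_closure_min; last first.
    by move=> r Rr; split; [apply: fR | move=> t; apply: NR].
  split.
  - by split=> [|t]; rewrite ?gmulf1 ?rewriting1.
  - move=> u v [fu Nu] [fv Nv]; split=> [|t].
      by rewrite gmulfM fu fv mulg1.
    by rewrite rewritingM; apply: NM.
  - move=> u [fu Nu]; split=> [|t]; first by rewrite gmulfV fu invg1.
    by rewrite rewritingV; apply: NV.
  - move=> u v [fu Nu]; split=> [|t]; first by rewrite gmulfJ fu conj1g.
    rewrite /conjg !rewritingM rewritingV fu mulg1.
    exact: (NJ (rewriting f (t * f v^-1) u)).
have /(NM _ _ Ny) := rewritingK_mod fs nNP NE y.
by rewrite mulVKg.
Qed.

(** * Residual finiteness of free groups *)

Section Unitriangular.
Variables (q k m : nat).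
Hypotheses (q_pr : prime q) (k_gt0 : (0 < k)%N).

Local Notation A := 'Z_(q ^ k).
Local Notation M := 'M[A]_m.+1.

Definition strictly_upper : {set M} :=
  [set B : M | [forall i : 'I_m.+1, forall j : 'I_m.+1,
                  (j <= i)%N ==> (B i j == 0%R)]].

Lemma strictly_upperP (B : M) :
  reflect (forall i j : 'I_m.+1, (j <= i)%N -> B i j = 0%R)
          (B \in strictly_upper).
Proof.
rewrite inE; apply: (iffP forallP) => [BP i j ij|BP i].
  by have /forallP/(_ j)/implyP/(_ ij)/eqP := BP i.
by apply/forallP => j; apply/implyP => /BP ->.
Qed.

Fact strictly_upper_group_set : group_set (strictly_upper : {set M}).
Proof.
apply/group_setP; split=> [|B C /strictly_upperP BP /strictly_upperP CP].
  by apply/strictly_upperP => i j _; rewrite mxE.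
by apply/strictly_upperP => i j ij; rewrite mxE BP ?CP ?addr0.
Qed.
Canonical strictly_upper_group := Group strictly_upper_group_set.

Lemma pnat_card_strictly_upper : q.-nat #|strictly_upper|.
Proof.
have := cardSg (finset.subsetT strictly_upper_group).
move=> /pnat_dvd -> //.
rewrite cardsT card_mx card_ord Zp_cast; last first.
  by rewrite -(exp1n k) ltn_exp2r // prime_gt1.
by rewrite !pnatX pnat_id.
Qed.

Lemma unitr_strictly_upper (B : M) :
  B \in strictly_upper -> (1 + B)%R \is a GRing.unit.
Proof.
move=> /strictly_upperP BP; rewrite -[_ \is a _]/(_ \in unitmx) unitmxE -det_tr.
rewrite det_trig; last first.
  apply/is_trig_mxP => i j ij.
  by rewrite !mxE BP 1?ltnW // addr0 -val_eqE gtn_eqF.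
by rewrite big1 ?unitr1 // => i _; rewrite !mxE BP // eqxx addr0.
Qed.

Definition unitriangular : {set {unit M}} :=
  [set u | (val u - 1)%R \in strictly_upper].

Lemma in_unitriangular u :
  (u \in unitriangular) = ((val u - 1)%R \in strictly_upper).
Proof. by rewrite /unitriangular finset.in_set. Qed.

Fact unitriangular_group_set : group_set unitriangular.
Proof.
apply/group_setP; split=> [|u v]; rewrite !in_unitriangular.
  rewrite subrr; apply: (group1 strictly_upper_group).
move=> /strictly_upperP uP /strictly_upperP vP.
have -> : (val (u * v)%g - 1 =
    (val u - 1) * (val v - 1) + (val u - 1) + (val v - 1))%R.
  by rewrite FinRing.val_unitM mulrBr mulr1 subrK mulrBl mul1r addrA subrK.
apply/strictly_upperP => i j ij; rewrite 2!mxE (uP _ _ ij) (vP _ _ ij) !addr0.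
rewrite mxE big1 // => l _.
have [li|il] := leqP l i; first by rewrite uP ?mul0r.
by rewrite vP ?mulr0 // (leq_trans ij) // ltnW.
Qed.
Canonical unitriangular_group := Group unitriangular_group_set.

(** Adding 1 matches the strictly upper triangular matrices with this group, so both have the same
    order. *)
Lemma pgroup_unitriangular : q.-group unitriangular.
Proof.
suff e : #|unitriangular| = #|strictly_upper|.
  by rewrite /pgroup e pnat_card_strictly_upper.
have inj : injective (fun u : {unit M} => val u - 1)%R.
  by move=> u v /addIr/val_inj.
rewrite -(card_imset _ inj); apply: eq_card => B.
apply/imsetP/idP => [[u uU ->]|BU].
  by rewrite -in_unitriangular.
exists (FinRing.unit M (unitr_strictly_upper BU)).
  by rewrite in_unitriangular /= addrC addKr.
by rewrite /= addrC addKr.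
Qed.

End Unitriangular.

(** * Syllables and a finite Magnus representation *)

Section Syllables.
Variable X : choiceType.
Implicit Types (s : seq (letter X * nat)) (w : seq (letter X)).

(** A pair [((x, b), n)] stands for the power [n.+1] of the letter [(x, b)]; adjacent syllables must
    differ in the generator [x], whatever their signs. *)
Definition syllabic s := sorted (fun p p' => p.1.1 != p'.1.1) s.

Lemma free_group_syllables (w : free_group X) :
  exists2 s, syllabic s & w = \prod_(p <- s) free_letter p.1 ^+ p.2.+1.
Proof.
(* The head letter is carried through the induction to decide whether a new letter extends the first
   syllable. *)
suff [s [ss -> _]] : exists s, [/\ syllabic s,
    w = \prod_(p <- s) free_letter p.1 ^+ p.2.+1 &
    ohead w = omap (fun p => p.1) (ohead s)] by exists s.
case: w => w rw /=; elim: w rw => [|a w IHw] rw.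
  by exists [::]; split=> //; rewrite big_nil; apply/val_inj.
have rw' : reduced w := path_sorted rw.
rewrite (free_group_cons rw rw').
case: (IHw rw') => -[|[b n] s] [ss -> hw].
  by exists [:: (a, 0%N)]; split=> //; rewrite big_nil big_seq1 mulg1.
have [ab|nab] := eqVneq a b.
  exists ((a, n.+1) :: s); split=> //; first by rewrite ab; case: s ss {hw}.
  by rewrite !big_cons ab [in RHS]expgS mulgA.
exists [:: (a, 0%N), (b, n) & s]; split=> //; last first.
  by rewrite [RHS]big_cons /= expg1.
rewrite /syllabic /= in ss *; rewrite ss andbT.
case: w hw rw {rw' IHw} => //= _ w [->] /andP[nba _].
(* Two different letters on the same generator are mutually inverse, and a reduced word never has
   them side by side. *)
apply: contra_neq nba => ab1; rewrite /letter_inv ab1.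
by move: nab ab1; case: (a) (b) => [x []] [y []] //= ne e; rewrite e eqxx in ne.
Qed.

End Syllables.

Section MagnusMatrices.
Variables (X : choiceType) (A : comNzRingType).
Variables (p0 : letter X * nat) (s : seq (letter X * nat)).
Hypothesis ss : syllabic s.

Local Notation m := (size s).
Local Notation M := 'M[A]_m.+1.
Local Open Scope ring_scope.

(** The image of the Magnus variable of [x] in a representation tailored to [s]: the superdiagonal
    marks the syllables on [x]. *)
Definition magnus_step (x : X) : M :=
  \matrix_(i, j) ((j == i.+1 :> nat) && ((nth p0 s i).1.1 == x))%:R.

Lemma magnus_step_upper x (i j : 'I_m.+1) :
  (j <= i)%N -> magnus_step x i j = 0.
Proof. by move=> ji; rewrite mxE ltn_eqF // ltnS. Qed.

Lemma magnus_step_mul x (B : M) (i l : 'I_m.+1) : (i < m)%N ->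
  (magnus_step x * B) i l =
  ((nth p0 s i).1.1 == x)%:R * B (inord i.+1) l.
Proof.
move=> im; rewrite mxE (bigD1 (inord i.+1)) //= big1 ?addr0 => [|j ji].
  by rewrite mxE inordK ?ltnS // eqxx.
rewrite mxE; case: eqP => [e|]; last by rewrite mul0r.
by case/eqP: ji; apply/val_inj; rewrite /= inordK ?ltnS // e.
Qed.

Lemma magnus_step_mul_max x (B : M) l : (magnus_step x * B) ord_max l = 0.
Proof.
rewrite mxE big1 // => j _; rewrite magnus_step_upper ?mul0r //.
by rewrite -ltnS ltn_ord.
Qed.

(** A nonzero entry would need two consecutive syllables on the generator [x], against [ss]. *)
Lemma magnus_step_sq x : magnus_step x * magnus_step x = 0.
Proof.
apply/matrixP => i l; rewrite [RHS]mxE; have [im|mi] := ltnP i m; last first.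
  rewrite (_ : i = ord_max) ?magnus_step_mul_max //; apply/val_inj/eqP.
  by rewrite eqn_leq mi -ltnS ltn_ord.
rewrite magnus_step_mul // mxE inordK ?ltnS //.
case: eqP => [e1|_]; last by rewrite mul0r.
case: eqP => [l2|_] /=; last by rewrite mulr0.
case: eqP => [e2|_]; last by rewrite mulr0.
have im2 : (i.+1 < m)%N by rewrite -ltnS -l2.
by have /(sortedP p0)/(_ i im2) := ss; rewrite e1 e2 eqxx.
Qed.

Lemma magnus_step_exp x (c : A) n :
  (1 + c *: magnus_step x) ^+ n = 1 + (c *+ n) *: magnus_step x.
Proof.
elim: n => [|n IHn]; first by rewrite mulr0n scale0r addr0.
rewrite exprS IHn mulrDl mul1r mulrDr mulr1 -scalerAl -scalerAr.
by rewrite magnus_step_sq !scaler0 addr0 -addrA -scalerDl mulrSr.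
Qed.

Definition syllable_coef (p : letter X * nat) : A :=
  ((-1) ^+ p.1.2) *+ p.2.+1.

(** Each factor moves at most one column to the right, so going from the first to the last of
    [size s + 1] columns takes a step in every factor. *)
Lemma magnus_prod_entry :
  (\prod_(p <- s) (1 + syllable_coef p *: magnus_step p.1.1) : M) ord0 ord_max
  = \prod_(p <- s) syllable_coef p.
Proof.
pose P i : M :=
  \prod_(p <- drop i s) (1 + syllable_coef p *: magnus_step p.1.1).
(* Induction from the end of [s]: the factors from [i] on are too few to lead from a row before [i]
   to the last column. *)
suff PE d i : (i + d)%N = m ->
    (forall k : 'I_m.+1, (k < i)%N -> P i k ord_max = 0) /\
    P i (inord i) ord_max = \prod_(p <- drop i s) syllable_coef p.
  have [_] := PE m 0%N (add0n _); rewrite /P drop0 => <-; congr (_ _ _ _).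
  by apply/val_inj; rewrite /= inordK.
elim: d i => [|d IHd] i.
  rewrite addn0 => ->; rewrite /P drop_size !big_nil; split=> [k km|].
    by rewrite mxE -val_eqE /= ltn_eqF.
  by rewrite mxE -val_eqE /= inordK // eqxx.
rewrite addnS -addSn => e; have [P0 P1] := IHd _ e.
have im : (i < m)%N by rewrite -e leq_addr.
have PS : P i = P i.+1 +
    syllable_coef (nth p0 s i) *: (magnus_step (nth p0 s i).1.1 * P i.+1).
  by rewrite /P (drop_nth p0) // big_cons mulrDl mul1r -scalerAl.
split=> [k ki|].
  rewrite PS mxE P0 ?(ltn_trans ki) // add0r mxE.
  rewrite magnus_step_mul ?(ltn_trans ki) //.
  by rewrite P0 ?inordK ?mulr0 // ltnS ?(leq_trans ki) // ltnW.
rewrite PS mxE P0 ?inordK ?add0r ?ltnS // 1?ltnW // mxE.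
have ii : (inord i : 'I_m.+1) = i :> nat by rewrite inordK // ltnS ltnW.
by rewrite magnus_step_mul ii // eqxx mul1r P1 (drop_nth p0 im) big_cons.
Qed.

End MagnusMatrices.

Lemma free_lift_in (X : choiceType) (Q : finGroupType) (K : {group Q})
    (g : X -> Q) (w : free_group X) :
  (forall x, g x \in K) -> free_lift g w \in K.
Proof.
move=> gK; elim/free_group_ind: w => [|[x b] w IHw].
  by rewrite gmulf1 group1.
rewrite gmulfM groupM //= free_lift_letter.
by case: b; rewrite ?groupV.
Qed.

(** Quotients are compared below by the order of a whole group type, so a subgroup has to become
    one. *)
Lemma corestrict_morphism (F : groupType) (Q : finGroupType) (K : {group Q})
    (f : UMagmaMorphism.type F Q) :
  (forall w, f w \in K) ->
  exists f' : UMagmaMorphism.type F (subg_of K), forall w, sgval (f' w) = f w.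
Proof.
move=> fK; pose f' w := subg K (f w).
have f'K w : sgval (f' w) = f w by rewrite subgK.
have f'1 : f' 1 = 1 by apply: subg_inj; rewrite f'K gmulf1.
have f'M : {morph f' : u v / u * v}.
  by move=> u v; apply: subg_inj; rewrite f'K gmulfM -!f'K.
pose f'I := isUMagmaMorphism.Build _ _ f' (f'1, f'M).
by exists (HB.pack_for (UMagmaMorphism.type F (subg_of K)) f' f'I).
Qed.

(* Over the integers the corner entry below is the non-zero coefficient of the
   Magnus expansion of [w] at the monomial listing its syllables; it stays
   non-zero modulo a large power of [q]. *)
Lemma free_group_residually_p (X : choiceType) (q : nat) (w : free_group X) :
  prime q -> w <> 1 ->
  exists (Q : finGroupType) (f : UMagmaMorphism.type (free_group X) Q),
    q.-nat #|Q| /\ f w <> 1.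
Proof.
move=> q_pr; have [s ss ->] := free_group_syllables w.
case: s ss => [|p0 s'] ss w1; first by rewrite big_nil in w1.
set s := p0 :: s' in ss w1 *.
(* Up to sign the corner entry is [k], and [k < q ^ k] keeps it nonzero modulo [q ^ k]. *)
pose k := (\prod_(p <- s) p.2.+1)%N.
have k_gt0 : (0 < k)%N by apply: prodn_gt0.
have kq : (k < q ^ k)%N by rewrite ltn_expl ?prime_gt1.
have qk_gt1 : (1 < q ^ k)%N by rewrite (leq_ltn_trans k_gt0).
pose D := magnus_step 'Z_(q ^ k) p0 s.
have DU x : D x \in strictly_upper q k (size s).
  by apply/strictly_upperP => i j; apply: magnus_step_upper.
pose g x := FinRing.unit _ (unitr_strictly_upper (DU x)).
have gU x : g x \in unitriangular_group q k (size s).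
  by rewrite in_unitriangular /= addrC addKr.
have [f fE] := corestrict_morphism (fun w => free_lift_in w gU).
exists _, f; split; first by rewrite card_sub; apply: pgroup_unitriangular.
move/(congr1 sgval); rewrite fE /= => /(congr1 val).
(* As [D x] has square zero, [1 - D x] is the inverse of [1 + D x]. *)
have letterE a : val (free_lift g (free_letter a)) =
    (1 + (-1) ^+ a.2 *: D a.1)%R.
  case: a => x b; rewrite free_lift_letter; case: b; last by rewrite /= scale1r.
  apply: (mulrI (unitr_strictly_upper (DU x))).
  rewrite /= mulrV ?unitr_strictly_upper // scaleN1r mulrBr mulr1 mulrDl mul1r.
  by rewrite (magnus_step_sq _ _ ss) addr0 addrK.
rewrite gmulf_prod (big_morph val (@FinRing.val_unitM _) (erefl _)).
under eq_bigr => p _ do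
  rewrite gmulfXn FinRing.val_unitX letterE (magnus_step_exp _ ss).
move/matrixP/(_ ord0 ord_max); rewrite (magnus_prod_entry _ _ s).
rewrite mxE /= => /eqP; apply/negP.
rewrite /syllable_coef; under eq_bigr do rewrite -mulr_natr.
rewrite big_split /= prodrXr -natr_prod -/k.
apply/eqP => /(congr1 (fun x => (-1) ^+ (\sum_(p <- s) p.1.2)%N * x)%R).
rewrite signrMK mulr0 => /(congr1 (@nat_of_ord _)).
by rewrite val_Zp_nat //= modn_small //; move=> k0; rewrite k0 in k_gt0.
Qed.

(* A smallest [q]-quotient of [X] not killing all of [U]: modulo any central
   subgroup of order [q] it becomes smaller and hence kills [U]. *)
Lemma free_group_minimal_quotient (X : choiceType) (q : nat)
    (U : set (free_group X)) (u : free_group X) :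
  prime q -> U u -> u <> 1 ->
  exists (Q : finGroupType) (f : UMagmaMorphism.type (free_group X) Q),
    [/\ q.-nat #|Q|, range f = setT, exists2 v, U v & f v <> 1 &
        forall v, U v -> f v ^+ q = 1].
Proof.
move=> q_pr Uu u1.
(* Surjectivity is left out of [good]: minimality yields it, since a proper image would be a smaller
   candidate. *)
pose good n := exists (Q : finGroupType)
  (f : UMagmaMorphism.type (free_group X) Q),
  [/\ q.-nat #|Q|, #|Q| = n & exists2 v, U v & f v <> 1].
have ex_good : exists n, `[< good n >].
  have [Q [f [qQ fu]]] := free_group_residually_p q_pr u1.
  by exists #|Q|; apply/asboolP; exists Q, f; split=> //; exists u.
case: (ex_minnP ex_good) => n /asboolP[Q [f [qQ Qn [v0 Uv0 fv0]]]] minQ.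
(* Used for the quotient by a central subgroup and for the image of [f]. *)
have minK (Q' : finGroupType) (K : {group Q'})
    (g : UMagmaMorphism.type (free_group X) Q') v :
    q.-group K -> (forall w, g w \in K) -> U v -> g v <> 1 -> (#|Q| <= #|K|)%N.
  move=> qK /corestrict_morphism[g' g'E] Uv gv; rewrite Qn minQ //.
  have cK : #|{: subg_of K}| = #|K| by rewrite card_sub.
  apply/asboolP; exists (subg_of K), g'; split=> //; first by rewrite cK.
  by exists v => // g'v; apply: gv; rewrite -g'E g'v.
exists Q, f; split=> //; last 2 first.
- by exists v0.
- move=> v Uv.
  have qT : q.-group (setT_group Q) by rewrite /pgroup /= cardsT.
  have T1 : setT_group Q :!=: 1%g.
    apply: contra_notN fv0 => /eqP T1.
    have : f v0 \in gval (setT_group Q) by rewrite finset.in_setT.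
    by rewrite T1 => /set1gP.
  have [z Zz oz] : exists2 z, z \in 'Z(setT_group Q) & #[z] = q.
    have [_ qZ _] : [/\ prime q, q %| #|'Z(setT_group Q)| &
        exists m, #|'Z(setT_group Q)| = (q ^ m.+1)%N].
      apply: pgroup_pdiv; first exact: pgroupS (center_sub _) qT.
      by rewrite (center_nil_eq1 (pgroup_nil qT)).
    by have [z Zz oz] := Cauchy q_pr qZ; exists z.
  have nz : setT_group Q \subset 'N(<[z]>).
    by rewrite cents_norm // centsC cycle_subG; case/setIP: Zz.
  have z1 : <[z]> :!=: 1%g.
    by rewrite cycle_eq1 -order_eq1 oz gtn_eqF ?prime_gt1.
  have lt_Qz := ltn_quotient z1 (finset.subsetT _ : <[z]> \subset setT_group Q).
  suff fvz : f v \in <[z]>.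
    by apply/eqP; rewrite -order_dvdn -oz; apply: order_dvdG.
  have [//|nfvz] := boolP (f v \in <[z]>).
  have nzw w : f w \in 'N(<[z]>).
    by apply: (fintype.subsetP nz); rewrite finset.in_setT.
  pose g w := coset <[z]> (f w).
  have g1 : g 1 = 1 by rewrite /g gmulf1 morph1.
  have gM : {morph g : w w' / w * w'}.
    by move=> w w'; rewrite /g gmulfM morphM ?nzw.
  pose gI := isUMagmaMorphism.Build _ _ g (g1, gM).
  pose gQ := HB.pack_for (UMagmaMorphism.type _ (coset_of <[z]>)) g gI.
  have gQz w : gQ w \in (setT_group Q / <[z]>)%G.
    by rewrite /= mem_quotient ?finset.in_setT.
  have gv : gQ v <> 1 by move=> gv1; case/negP: nfvz; apply: coset_idr.
  have := minK _ _ _ _ (quotient_pgroup _ qT) gQz Uv gv.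
  by rewrite leqNgt -[#|Q|]cardsT lt_Qz.
- pose K := [set t | `[< range f t >]]%SET.
  have gK : group_set K.
    apply/group_setP; split=> [|x y]; rewrite !finset.in_set.
      by apply/asboolP; exists 1 => //; rewrite gmulf1.
    move=> /asboolP[a _ <-] /asboolP[b _ <-]; apply/asboolP.
    by exists (a * b) => //; rewrite gmulfM.
  have fK w : f w \in Group gK.
    by rewrite /= finset.in_set; apply/asboolP; exists w.
  have qK : q.-group (Group gK).
    apply: (@pgroupS _ _ (setT_group Q)); first exact: finset.subsetT.
    by rewrite /pgroup /= cardsT.
  have cK := minK _ _ _ _ qK fK Uv0 fv0.
  apply/seteqP; split=> // t _.
  suff : t \in K by rewrite finset.in_set => /asboolP.
  suff -> : K = finset.setTfor Q by rewrite finset.in_setT.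
  by apply/eqP; rewrite eqEcard finset.subsetT cardsT.
Qed.

(** * Valuations and deficiency *)

Section PValuation.
Variables (p : nat) (X : finType).
Hypothesis p_pr : prime p.
Implicit Types w : free_group X.

(** The default value 0 is harmless: every element is its own [p ^ 0]-th power. *)
Lemma is_power_pvaluation w : is_power (p ^ pvaluation p w) w.
Proof.
rewrite /pvaluation; case: xgetP => [k _ []//|_].
by exists w; rewrite expg1.
Qed.

(** If [w] survives in a quotient of order [p ^ n], it is a [p ^ j]-th power only for [j] at most
    [n], so the maximum exists. *)
Lemma is_power_leq_pvaluation w k :
  w <> 1 -> is_power (p ^ k) w -> (k <= pvaluation p w)%N.
Proof.
move=> w1 wk; rewrite /pvaluation; case: xgetP => [j _ [_]|none]; first exact.
have [Q [f [/p_natP[n Qn] fw]]] := free_group_residually_p p_pr w1.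
pose good j := `[< is_power (p ^ j) w >].
have good_le j : good j -> (j <= n)%N.
  move=> /asboolP[v wv]; rewrite leqNgt; apply/negP => /ltnW nj; apply: fw.
  have fv : f v ^+ #|Q| = 1 by rewrite -cardsT expg_cardG // finset.in_setT.
  by rewrite wv gmulfXn -(subnKC nj) expnD expgnA -Qn fv expg1n.
have ex_good : exists j, good j by exists k; apply/asboolP.
case: (ex_maxnP ex_good good_le) => j /asboolP wj max_j.
by case: (none j); split=> // i wi; apply: max_j; apply/asboolP.
Qed.

End PValuation.

(** If [r = v ^+ (p ^ k)], the order of [f v] divides both [p ^ k] and [#|Q|]. Hence [f v = 1], and
    the path of [r] repeats the closed path of [v]. *)
Lemma rewriting_pvaluation (p : nat) (X : finType) (Q : finGroupType)
    (f : UMagmaMorphism.type (free_group X) Q) (t : Q) (r : free_group X) :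
  prime p -> coprime p #|Q| -> r <> 1 -> f r = 1 ->
  (pvaluation p r <= pvaluation p (rewriting f t r))%N.
Proof.
move=> p_pr coQ r1 fr; apply: is_power_leq_pvaluation => //.
  by move=> tr1; apply: r1; apply: (@rewriting_inj _ _ f t).
have [v rv] := is_power_pvaluation p r; exists (rewriting f t v).
rewrite -rewritingX -?rv //.
have fvQ : f v ^+ #|Q| = 1 by rewrite -cardsT expg_cardG // finset.in_setT.
have fvp : f v ^+ (p ^ pvaluation p r) = 1 by rewrite -gmulfXn -rv.
apply/eqP; rewrite -order_eq1 -dvdn1.
rewrite -(eqP (coprimeXl (pvaluation p r) coQ)) dvdn_gcd !order_dvdn.
by rewrite fvQ fvp eqxx.
Qed.

(** A union bound: the [B j] may overlap. *)
Lemma esum_cover (K : realType) (T : choiceType) (J : finType)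
    (A : set T) (B : J -> set T) (a : T -> \bar K) :
  (forall x, (0 <= a x)%E) -> (forall x, A x -> exists j, B j x) ->
  ((\esum_(x in A) a x)%R <= \sum_j (\esum_(x in B j) a x)%R)%E.
Proof.
move=> a0 AB; rewrite esum_mkcond.
under [leRHS]eq_bigr do rewrite esum_mkcond.
rewrite -esum_sum => [|x j _ _]; last by case: ifP.
apply: le_esum => x _; case: ifPn => [|_]; last first.
  by apply: sume_ge0 => j _; case: ifP.
move=> /set_mem/AB[j Bj]; rewrite (bigD1 j) //= mem_set // leeDl //.
by apply: sume_ge0 => i _; case: ifP.
Qed.

Lemma esumD1 (K : realType) (T : choiceType) (A : set T) (x : T)
    (a : T -> \bar K) :
  (forall y, (0 <= a y)%E) -> A x ->
  ((\esum_(y in A) a y)%R = a x + (\esum_(y in A `\ x) a y)%R)%E.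
Proof.
move=> a0 Ax; rewrite (esumID [set x]) //; congr (_ + _)%E.
by rewrite (_ : A `&` [set x] = [set x]) ?esum_set1 // setIidr // => _ ->.
Qed.

Lemma p_weight_ge0 (K : realType) (p n : nat) :
  (0 <= (p%:R ^- n)%R%:E :> \bar K)%E.
Proof. by rewrite lee_fin invr_ge0 exprn_ge0 // ler0n. Qed.

Lemma p_weight_le (K : realType) (p m n : nat) :
  prime p -> (m <= n)%N -> ((p%:R ^- n)%R%:E <= (p%:R ^- m)%R%:E :> \bar K)%E.
Proof.
move=> p_pr mn; have p0 : (0 < p%:R :> K)%R by rewrite ltr0n prime_gt0.
rewrite lee_fin lef_pV2 ?posrE ?exprn_gt0 // ler_weXn2l // ler1n.
exact: prime_gt0.
Qed.

Theorem theorem7 (K : realType) (p q : nat) (X : finType)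
    (R : set (free_group X)) (G : groupType) :
  prime p -> prime q -> q != p ->
  (R !=set0)%classic ->
  ~ R 1%g ->
  pres_pdeficiency K p R = 0%E ->
  (forall r : free_group X, R r -> is_power q r) ->
  presents R G ->
  exists S : groupClosed G,
    finite_index S /\ (0 < pdeficiency K p (subgroup S))%E.
Proof.
move=> p_pr q_pr qp [r1 Rr1] nR1 defR powR presR.
have [u1 r1E] := powR _ Rr1.
have u1_neq1 : u1 <> 1 by move=> e; apply: nR1; rewrite -(expg1n _ q) -e -r1E.
pose U := [set u | R (u ^+ q)].
have [Q [f [qQ f_surj [u0 Uu0 fu0] fU]]] :
    exists (Q : finGroupType) (f : UMagmaMorphism.type (free_group X) Q),
    [/\ q.-nat #|Q|, range f = setT, exists2 v, U v & f v <> 1 &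
        forall v, U v -> f v ^+ q = 1].
  by apply: free_group_minimal_quotient q_pr _ u1_neq1; rewrite /U /= -r1E.
have fR r : R r -> f r = 1.
  by move=> Rr; have [u ru] := powR _ Rr; rewrite ru gmulfXn fU // /U /= -ru.
have coQ : coprime p #|Q|.
  have [n ->] := p_natP qQ; apply: coprimeXr.
  by rewrite prime_coprime // dvdn_prime2 // eq_sym.
(* With [s 1 = 1] the transversal relator at 1 is trivial, so only [#|Q| - 1] of them count. *)
have [s fs s1] : exists2 s, cancel s f & s 1 = 1.
  have /choice[s0 fs0] t : exists w, f w = t.
    by have [w _ <-] : range f t by [rewrite f_surj]; exists w.
  exists (fun t => if t == 1 then 1 else s0 t); last by rewrite eqxx.
  by move=> t; case: eqP => [->|_]; rewrite ?gmulf1.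
pose r0 := u0 ^+ q; pose t0 := f u0.
have r_neq1 r : R r -> r <> 1 by move=> Rr r_eq1; rewrite r_eq1 in Rr.
have rw_neq1 t r : R r -> rewriting f t r <> 1.
  by move=> Rr /(@rewriting_inj _ _ f t r 1)/r_neq1; apply.
pose tree_rels (t : Q) : set (free_group (Q * X)%type) :=
  if t == 1 then set0 else [set rewriting f 1 (s t)].
(* The relator left out is [r0] read from [t0]. *)
pose conj_rels t : set (free_group (Q * X)%type) :=
  rewriting f t @` (R `\` [set r | (t, r) = (t0, r0)]).
(* [pdeficiency] only admits presentations without the relator 1. *)
pose P := [set y | y <> 1 /\ exists t, tree_rels t y \/ conj_rels t y].
have NE t : normal_closure P (rewriting f 1 (s t)).
  have [N1 _ _ _] := normal_closure_normal P.
  have [->//|ne] := pselect (rewriting f 1 (s t) = 1).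
  apply: sub_normal_closure; split=> //; exists t; left; rewrite /tree_rels.
  by case: eqP ne => // ->; rewrite s1 rewriting1.
have conjP t r : R r -> (t, r) <> (t0, r0) -> P (rewriting f t r).
  move=> Rr ne; split; first exact: rw_neq1.
  by exists t; right; exists r.
have NR t r : R r -> normal_closure P (rewriting f t r).
  have [[-> ->] Rr|ne Rr] := pselect ((t, r) = (t0, r0)); last first.
    by apply: sub_normal_closure; apply: conjP.
  (* As [u0] commutes with its power [r0], reading their product from 1 in both orders makes the
     omitted relator a conjugate of [r0] read from 1. The latter is kept because [t0 <> 1]. *)
  have e : rewriting f 1 u0 * rewriting f t0 r0 =
           rewriting f 1 r0 * rewriting f 1 u0.
    have <- : rewriting f 1 (u0 * r0) = rewriting f 1 u0 * rewriting f t0 r0.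
      by rewrite rewritingM mul1g.
    by rewrite /r0 -expgS expgSr rewritingM mul1g fR.
  have [_ _ _ NJ] := normal_closure_normal P.
  suff : normal_closure P (rewriting f 1 r0 ^ rewriting f 1 u0).
    by rewrite /conjg -e mulKg.
  by apply: NJ; apply: sub_normal_closure; apply: conjP => // -[/esym/fu0].
have sPER y : P y -> (exists t, y = rewriting f 1 (s t)) \/
     exists t r, R r /\ y = rewriting f t r.
  move=> [_ [t [|[r [Rr _] <-]]]]; last by right; exists t, r.
  by rewrite /tree_rels; case: eqP => // _ ->; left; exists t.
have [S [iS presS]] := presents_finite_index_subgroup fs s1 presR fR NE NR sPER.
exists S; split=> //.
apply: (@lt_le_trans _ _ (pres_pdeficiency K p P)); last first.
  by apply: ereal_sup_ubound; exists (Q * X)%type, P; split=> // -[].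
pose wt (Y : finType) (y : free_group Y) : \bar K :=
  (p%:R ^- pvaluation p y)%R%:E.
have wt_ge0 Y y : (0 <= wt Y y)%E by apply: p_weight_ge0.
pose sigma : K := (#|X|%:R - 1)%R.
(* Deficiency 0 rules out an infinite sum. *)
have esumR : esum R (@wt X) = sigma%:E.
  move: defR; rewrite /pres_pdeficiency -/(esum R (@wt X)) -/sigma.
  by case: (esum R _) => // x [] /eqP; rewrite subr_eq0 => /eqP ->.
pose beta : K := (p%:R ^- pvaluation p r0)%R.
have beta_gt0 : (0 < beta)%R.
  by rewrite invr_gt0 exprn_gt0 // ltr0n prime_gt0.
have tree_le (t : Q) : (esum (tree_rels t) (@wt _) <= (t != 1%g)%:R%:E)%E.
  rewrite /tree_rels; case: eqP => _; first by rewrite esum_set0.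
  rewrite esum_set1 //; set y := rewriting _ _ _.
  have := p_weight_le K p_pr (leq0n (pvaluation p y)).
  by rewrite expr0 invr1.
(* Readings weigh no more than their relators, and at [t0] the omission saves [beta]. *)
have conj_le t :
    (esum (conj_rels t) (@wt _) <= (sigma - beta *+ (t == t0))%R%:E)%E.
  rewrite /conj_rels esum_image; last first.
    by move=> r r' _ _; apply: rewriting_inj.
  set Rt := R `\` _.
  have wt_le : (esum Rt (fun r => wt _ (rewriting f t r)) <= esum Rt (@wt _))%E.
    apply: le_esum => r [Rr _]; apply: p_weight_le => //.
    by apply: rewriting_pvaluation => //; [apply: r_neq1 | apply: fR].
  apply: (le_trans wt_le); have [tt0|nt] := eqVneq t t0.
    have -> : Rt = R `\ r0.
      apply/seteqP; split=> r [Rr nr]; split=> // -e; apply: nr.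
        by rewrite e tt0.
      by case: e.
    by rewrite mulr1n EFinB -esumR (@esumD1 _ _ R r0) // addeAC subee // add0e.
  have -> : Rt = R.
    apply/seteqP; split=> r; first by case.
    by move=> Rr; split=> // -[/eqP]; rewrite (negPf nt).
  by rewrite esumR mulr0n subr0.
have esumP : (esum P (@wt _) <=
    \sum_t (sigma - beta *+ (t == t0))%R%:E + \sum_(t : Q) (t != 1%g)%:R%:E)%E.
  pose B (j : Q + Q) :=
    match j with inl t => conj_rels t | inr t => tree_rels t end.
  apply: (le_trans (esum_cover (B := B) _ _)) => //.
    by move=> y [_ [t [ty|ty]]]; [exists (inr t) | exists (inl t)].
  by rewrite big_sumType; apply: leeD; apply: lee_sum => t _;
    [apply: conj_le | apply: tree_le].
(* With [n = #|Q|], the bound is [n|X| - 1 - (n(|X| - 1) - beta + n - 1) = beta]. *)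
apply: (@lt_le_trans _ _ beta%:E) => //.
rewrite /pres_pdeficiency -/(esum P (@wt _)).
rewrite !sumEFin -EFinD in esumP.
apply: (le_trans _ (leeB (lexx _) esumP)); rewrite -EFinB lee_fin.
have sum_t0 : (\sum_(t : Q) beta *+ (t == t0) = beta)%R.
  rewrite (bigD1 t0) //= eqxx big1 ?addr0 // => t /negPf ->; exact: mulr0n.
have sum_neq1 : (\sum_(t : Q) (t != 1%g)%:R = #|Q|%:R - 1 :> K)%R.
  rewrite (eq_bigr (fun t => 1 - (t == 1%g)%:R)%R) => [|t _]; last first.
    by case: eqP; rewrite ?subrr ?subr0.
  rewrite sumrB sumr_const (bigD1 1%g) //= eqxx big1 ?addr0 // => t /negPf ->.
  exact: mulr0n.
rewrite sumrB sumr_const sum_t0 sum_neq1 card_prod natrM -mulr_natr.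
rewrite (_ : #|_| = #|Q|) // /sigma le_eqVlt; apply/orP; left; apply/eqP.
ring.
Qed.
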